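(* Let $\mathcal{K}$ be a mean whose domain contains bounded sets only, and let $\hat{\mathcal{K}}$ be its extension. If $\mathcal{K}$ is shift-invariant, then $\hat{\mathcal{K}}$ is shift-invariant.
   Context: A (generalized) mean is a function $\mathcal{K}: Dom(\mathcal{K})\to\bar{\mathbb{R}}=\mathbb{R}\cup\{-\infty,+\infty\}$, where $Dom(\mathcal{K})$ is a collection of nonempty subsets of $\mathbb{R}$, with $\inf H\le\mathcal{K}(H)\le\sup H$ for all $H\in Dom(\mathcal{K})$ (so values on bounded sets are real). Standing assumption on the domain of the original mean $\mathcal{K}$: it is closed under finite unions and nonempty finite intersections, and if $H\in Dom(\mathcal{K})$ and $I$ is a (finite or infinite) interval with $H\cap I\neq\emptyset$ then $H\cap I\in Dom(\mathcal{K})$. Extension: let $\mathcal{K}$ be a mean whose domain contains bounded sets only. Let $\emptyset\neq H\subset\mathbb{R}$ be such that $H\cap[x,y]\in Dom(\mathcal{K})$ for all real $x\le y$ with $H\cap[x,y]\neq\emptyset$. Set $\hat{\mathcal{K}}(H)=\lim_{x\to-\infty,\,y\to+\infty}\mathcal{K}(H\cap[x,y])$ if this double limit (with $x,y$ tending independently) exists in $\bar{\mathbb{R}}$; $Dom(\hat{\mathcal{K}})$ consists of all such $H$ for which the limit exists. For $H\subset\mathbb{R}$, $x\in\mathbb{R}$, $H+x=\{h+x:h\in H\}$. A mean $\mathcal{M}$ is shift-invariant if for all $H\in Dom(\mathcal{M})$ and $x\in\mathbb{R}$ one has $H+x\in Dom(\mathcal{M})$ and $\mathcal{M}(H+x)=\mathcal{M}(H)+x$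 (with $\pm\infty+x=\pm\infty$). *)

(* Defs.v *)
From mathcomp Require Import all_boot all_order all_algebra.
From mathcomp Require Import all_classical all_reals all_analysis.

Set Implicit Arguments.
Unset Strict Implicit.
Unset Printing Implicit Defensive.

Import Order.TTheory GRing.Theory Num.Theory.
Import numFieldNormedType.Exports.

Local Open Scope classical_set_scope.
Local Open Scope ring_scope.

(* Partial functions are encoded as total ones together with a domain; the
   values outside [dom] are meaningless. *)
Record mean (R : realType) := Mean {
  dom : set (set R);
  mean_val :> set R -> \bar R;
  dom_nonempty : forall H, dom H -> H !=set0;
  mean_bounds : forall H, dom H ->
    (ereal_inf (EFin @` H) <= mean_val H <= ereal_sup (EFin @` H))%E }.

(* Binary unions and intersections suffice: if a finite intersection is
   nonempty, then so are all its partial intersections. *)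
Definition closed_domain (R : realType) (D : set (set R)) : Prop :=
  [/\ forall A B, D A -> D B -> D (A `|` B),
      forall A B, D A -> D B -> A `&` B !=set0 -> D (A `&` B) &
      forall (A : set R) (I : interval R),
        D A -> A `&` [set` I] !=set0 -> D (A `&` [set` I])].

Definition shift_set (R : realType) (H : set R) (x : R) : set R :=
  [set h + x | h in H].

Definition shift_invariant (R : realType) (M : mean R) : Prop :=
  forall (H : set R) (x : R), dom M H ->
    dom M (shift_set H x) /\ M (shift_set H x) = (M H + x%:E)%E.

(* x and y tend to -oo and +oo independently. *)
Definition truncations (R : realType) : set_system (R * R) :=
  filter_prod (ninfty_nbhs R) (pinfty_nbhs R).
Arguments truncations : clear implicits.

Definition trunc_mean (R : realType) (K : mean R) (H : set R) (p : R * R)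
  : \bar R := K (H `&` `[p.1, p.2]).

Definition ext_dom (R : realType) (K : mean R) : set (set R) :=
  [set H | [/\ H !=set0,
    forall x y : R, x <= y -> H `&` `[x, y] !=set0 -> dom K (H `&` `[x, y]) &
    cvg (trunc_mean K H @ truncations R)]].

Definition ext_val (R : realType) (K : mean R) (H : set R) : \bar R :=
  lim (trunc_mean K H @ truncations R).

Lemma truncations_proper (R : realType) : ProperFilter (truncations R).
Proof. exact: filter_prod_proper. Qed.

Lemma ext_nonempty (R : realType) (K : mean R) (H : set R) :
  ext_dom K H -> H !=set0.
Proof. by case. Qed.

Lemma ext_bounds (R : realType) (K : mean R) (H : set R) : ext_dom K H ->
  (ereal_inf (EFin @` H) <= ext_val K H <= ereal_sup (EFin @` H))%E.
Proof.
move=> [[h Hh] domK cvgK]; pose PF := truncations_proper R.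
have near_bounds : \forall p \near truncations R,
    (ereal_inf (EFin @` H) <= trunc_mean K H p <= ereal_sup (EFin @` H))%E.
  exists ([set x | x <= h], [set y | h <= y]).
    by split; [exact: (nbhs_ninfty_le (num_real h))
             |exact: (nbhs_pinfty_ge (num_real h))].
  move=> [x y] [/= xh hy].
  have /mean_bounds /andP[infK supK] : dom K (H `&` `[x, y]).
    apply: domK; first exact: le_trans hy.
    by exists h; split => //=; rewrite in_itv /= xh hy.
  apply/andP; split.
    apply: (le_trans _ infK); apply: ereal_inf_le_tmp.
    by apply: image_subset => ? [].
  apply: (le_trans supK); apply: ereal_sup_le.
  by apply: image_subset => ? [].
apply/andP; split.
  by apply: lime_ge => //; apply: filterS near_bounds => p /andP[].
by apply: lime_le => //; apply: filterS near_bounds => p /andP[].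
Qed.

Definition extension (R : realType) (K : mean R) : mean R :=
  Mean (@ext_nonempty R K) (@ext_bounds R K).

(* Main.v *)
Require Import Defs.
From mathcomp Require Import all_boot all_order all_algebra.
From mathcomp Require Import all_classical all_reals all_analysis.
Import numFieldNormedType.Exports.

Set Implicit Arguments.
Unset Strict Implicit.
Unset Printing Implicit Defensive.

Import Order.TTheory GRing.Theory Num.Theory.

(** Truncation windows translate along with the set: cutting [H + t] to [x, y]
    is the same as translating by [t] the set [H] cut to [x - t, y - t].  So as
    soon as the window meets [H + t], shift-invariance of [K] says that the
    truncated mean of [H + t] at [(x, y)] is [t] plus the truncated mean of [H]
    at [(x - t, y - t)].  Translating both endpoints by a constant preserves
    the double limit [x --> -oo], [y --> +oo], and adding the finite constant
    [t] is continuous on the extended reals, even at the infinities.  Hence the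
    limit for [H + t] exists and equals the limit for [H] plus [t]. *)

Local Open Scope classical_set_scope.
Local Open Scope ring_scope.

Lemma shift_set_itv (R : realType) (H : set R) (t x y : R) :
  shift_set H t `&` `[x, y] = shift_set (H `&` `[x - t, y - t]) t.
Proof.
apply/seteqP; split => z /=.
  move=> [[h Hh <-]]; rewrite in_itv /= => /andP[xh hy].
  by exists h => //; split => //; rewrite /= in_itv /= lerBlDr xh lerBrDr.
move=> [h [Hh]]; rewrite /= in_itv /= lerBlDr lerBrDr => /andP[xh hy] <-.
by split; [exists h | rewrite in_itv /= xh].
Qed.

Lemma truncations_shift (R : realType) (t : R) :
  (fun p : R * R => (p.1 - t, p.2 - t)) @ truncations R --> truncations R.
Proof.
move=> P [[A B] /= [[a [_ aA]] [b [_ bB]]] ABP].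
exists ([set x | x < a + t], [set y | b + t < y]).
  by split; [exists (a + t) | exists (b + t)]; split; rewrite ?num_real.
move=> [x y] [/= xa yb]; apply: ABP; split => /=.
  by apply: aA; rewrite ltrBlDr.
by apply: bB; rewrite ltrBrDr.
Qed.

Lemma near_truncations_meet (R : realType) (H : set R) : H !=set0 ->
  \forall p \near truncations R, H `&` `[p.1, p.2] !=set0.
Proof.
move=> [h Hh]; exists ([set x | x <= h], [set y | h <= y]).
  by split; [exact: (nbhs_ninfty_le (num_real h))
            |exact: (nbhs_pinfty_ge (num_real h))].
by move=> [x y] [/= xh hy]; exists h; split => //=; rewrite in_itv /= xh hy.
Qed.

Lemma itv_meet_le (R : realType) (H : set R) (x y : R) :
  H `&` `[x, y] !=set0 -> x <= y.
Proof. by move=> [h [_]]; rewrite /= in_itv /= => /andP[]; exact: le_trans. Qed.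

Lemma shift_set_truncation_dom (R : realType) (K : mean R) (H : set R)
    (t x y : R) :
    (forall a b : R, a <= b -> H `&` `[a, b] !=set0 -> dom K (H `&` `[a, b])) ->
    shift_set H t `&` `[x, y] !=set0 ->
  dom K (H `&` `[x - t, y - t]).
Proof.
rewrite shift_set_itv => domK [_ [h Hh _]].
have H0 : H `&` `[x - t, y - t] !=set0 by exists h.
exact: domK _ _ (itv_meet_le H0) H0.
Qed.

(** A window that misses [H + t] gives the meaningless value of [K] at the
    empty set, so the two truncated means are compared only near the limit,
    where every window meets [H + t]. *)
Lemma trunc_mean_shift_cvg (R : realType) (K : mean R) (H : set R) (t : R) :
    shift_invariant K -> ext_dom K H ->
  trunc_mean K (shift_set H t) @ truncations R --> (ext_val K H + t%:E)%E.
Proof.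
move=> K_shift [[h Hh] domK cvgK]; pose PF := truncations_proper R.
pose f (p : R * R) := (trunc_mean K H (p.1 - t, p.2 - t)%R + t%:E)%E.
have cvgf : f @ truncations R --> (ext_val K H + t%:E)%E.
  apply: cvgeD; [exact: fin_num_adde_defl | | exact: cvg_cst].
  exact: cvg_comp (@truncations_shift R t) cvgK.
apply: cvg_trans cvgf; apply: near_eq_cvg.
have Ht0 : shift_set H t !=set0 by exists (h + t), h.
apply: filterS (near_truncations_meet Ht0) => -[x y] /= Hxy.
rewrite /f /trunc_mean /= shift_set_itv.
by have [_ ->] := K_shift _ t (shift_set_truncation_dom domK Hxy).
Qed.

Theorem proposition4p15 (R : realType) (K : mean R)
  (K_closed : closed_domain (dom K))
  (K_bounded : forall H : set R, dom K H -> bounded_set H)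
  (K_shift : shift_invariant K) :
  shift_invariant (extension K).
Proof.
move=> H t /= extH; pose PF := truncations_proper R.
have cvgHt := trunc_mean_shift_cvg (t := t) K_shift extH.
split; last exact: cvg_lim cvgHt.
have [[h Hh] domK _] := extH; split.
- by exists (h + t), h.
- move=> x y _ Hxy; rewrite shift_set_itv.
  by have [] := K_shift _ t (shift_set_truncation_dom domK Hxy).
- by apply/cvg_ex; exists (ext_val K H + t%:E)%E.
Qed.
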